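(* Assume that for each task $q\in\mathcal{Q}$ not all agents are dominating for $q$. Let $\mathcal{G}_W$ be the weight game, and let $\hat{\mathbf W}=(\hat w_i^q)\in[0,1]^{n\times m}$ be a strategy profile. Then $\hat{\mathbf W}$ is a Nash equilibrium of $\mathcal G_W$ if and only if both of the following hold: 1. for each $q\in\mathcal Q$ there exists $i\in\mathcal A$ dominating for $q$ with $\hat w_i^q=1$; 2. if $j\in\mathcal A$ is not a dominating agent for task $q\in\mathcal Q$, then $\hat w_j^q=0$.
   Context: $\mathcal A=\{1,\dots,n\}$ is a finite set of agents and $\mathcal Q=\{1,\dots,m\}$ a finite set of tasks. For each $i\in\mathcal A$, $f_i:\mathcal Q\to\mathbb R_{\ge 0}$ is a given function. Agent $i$ is dominating for task $q$ if $f_i(q)\ge f_j(q)$ for all $j\in\mathcal A$. The weight game $\mathcal G_W$ is the strategic form game with agents $\mathcal A$ in which agent $i$ chooses a weight vector $\mathbf w_i=(w_i^q)_{q\in\mathcal Q}\in[0,1]^m$. A profile is a matrix $\mathbf W=(w_i^q)\in[0,1]^{n\times m}$, with row $i$ belonging to agent $i$. The utility of agent $i$ is $$U_i(\mathbf w_i,\mathbf w_{-i})=\sum_{q\in\mathcal Q}\Big[f_i(q)w_i^q-\max_{j\in\mathcal A\setminus\{i\}}f_j(q)w_j^q\,w_i^q\Big],$$ where $\mathbf w_{-i}$ denotes the weight vectors of all agents other than $i$. A profile $(\hat{\mathbf w}_i,\hat{\mathbf w}_{-i})$ is a Nash equilibrium if $U_i(\hat{\mathbf w}_i,\hat{\mathbf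 w}_{-i})\ge U_i(\mathbf w_i,\hat{\mathbf w}_{-i})$ for all $\mathbf w_i\in[0,1]^m$ and all $i\in\mathcal A$. *)

(* Defs.v *)
From HB Require Import structures.
From mathcomp Require Import all_boot all_order all_algebra.
From mathcomp Require Import reals.

Set Implicit Arguments.
Unset Strict Implicit.
Unset Printing Implicit Defensive.

Import Order.TTheory GRing.Theory Num.Theory.
Local Open Scope ring_scope.

(* Agents are 'I_n, tasks are 'I_m; f i q is the value f_i(q), and W i q is
   the weight w_i^q that agent i puts on task q. *)

Definition dominating (R : realType) (n m : nat) (f : 'I_n -> 'I_m -> R)
    (i : 'I_n) (q : 'I_m) : Prop :=
  forall j : 'I_n, f j q <= f i q.

Definition is_strategy (R : realType) (m : nat) (w : 'rV[R]_m) : Prop :=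
  forall q : 'I_m, 0 <= w 0 q <= 1.

Definition is_profile (R : realType) (n m : nat) (W : 'M[R]_(n, m)) : Prop :=
  forall i : 'I_n, is_strategy (row i W).

(* The maximum is started at 0. When f is nonnegative and W is a profile this
   is the ordinary maximum as soon as there is another agent; for n = 1 it
   fixes the value of the maximum over the empty set to be 0. *)
Definition utility (R : realType) (n m : nat) (f : 'I_n -> 'I_m -> R)
    (W : 'M[R]_(n, m)) (i : 'I_n) : R :=
  \sum_(q < m)
    (f i q * W i q
     - \big[Num.max/0]_(j < n | j != i) (f j q * W j q * W i q)).

(* The profile (w, W_{-i}): row i of W is replaced by w. *)
Definition deviate (R : realType) (n m : nat) (W : 'M[R]_(n, m))
    (i : 'I_n) (w : 'rV[R]_m) : 'M[R]_(n, m) :=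
  \matrix_(j < n, q < m) (if j == i then w 0 q else W j q).

Definition is_nash (R : realType) (n m : nat) (f : 'I_n -> 'I_m -> R)
    (W : 'M[R]_(n, m)) : Prop :=
  forall (i : 'I_n) (w : 'rV[R]_m), is_strategy w ->
    utility f (deviate W i w) i <= utility f W i.

(* Main.v *)
Require Import Defs.
From HB Require Import structures.
From mathcomp Require Import all_boot all_order all_algebra.
From mathcomp Require Import reals.

Set Implicit Arguments.
Unset Strict Implicit.
Unset Printing Implicit Defensive.

Import Order.TTheory GRing.Theory Num.Theory.
Local Open Scope ring_scope.

(** Fix the other agents' weights. The payoff that agent [i] collects on task
    [q] is linear in its own weight there, with slope
      [gap f W i q = f i q - max_(j != i) f j q * W j q],
    because a nonnegative weight factors out of the maximum. Utilities are sums
    over tasks and a deviation may alter a single task, so an equilibrium is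
    exactly a profile in which every single weight is a best response to its
    own slope ([nashP]): weight 1 when the slope is positive, weight 0 when it
    is negative, anything when it vanishes ([optimal_weightP]).

    It remains to read off the signs. Let [i] be dominating for [q]; since not
    all agents dominate, [f i q > 0]. If no dominating agent had weight 1, then
    every discounted value [f j q * W j q] would be strictly below [f i q], so
    the slope of [i] would be positive and [i] would have weight 1 after all.
    Once some dominating agent has weight 1, every agent that is not dominating
    faces a competitor of full value, so its slope is negative and its weight
    is 0. Conversely, a dominating agent always has a slope [>= 0], and this
    slope is 0 as soon as another dominating agent has weight 1; thus under the
    two conditions all weights are best responses. *)

Section WeightGame.

Variables (R : realType) (n m : nat) (f : 'I_n -> 'I_m -> R).
Implicit Types (W : 'M[R]_(n, m)) (i j : 'I_n) (q : 'I_m) (w : 'rV[R]_m).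

Definition gap W i q : R :=
  f i q - \big[Num.max/0]_(j < n | j != i) (f j q * W j q).

Definition optimal_weight (a x : R) : Prop :=
  forall t : R, 0 <= t <= 1 -> a * t <= a * x.

Lemma optimal_weightP (a x : R) : 0 <= x <= 1 ->
  optimal_weight a x <-> (0 < a -> x = 1) /\ (a < 0 -> x = 0).
Proof.
move=> /andP[x_ge0 x_le1]; split=> [opt | [pos neg] t /andP[t_ge0 t_le1]].
  split=> sgn_a; apply/eqP; rewrite eq_le ?x_le1 ?x_ge0 /= ?andbT.
  - by rewrite -(ler_pM2l sgn_a); apply: opt; rewrite ler01 lexx.
  - by rewrite -(ler_nM2l sgn_a); apply: opt; rewrite ler01 lexx.
case: (ltgtP a 0) => [a_lt0 | a_gt0 | ->]; last by rewrite !mul0r.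
- by rewrite neg // ler_nM2l.
- by rewrite pos // ler_pM2l.
Qed.

Lemma deviate_row W i : deviate W i (row i W) = W.
Proof. by apply/matrixP=> j q; rewrite !mxE; case: eqP => // ->. Qed.

Lemma utility_deviate W i w : is_strategy w ->
  utility f (deviate W i w) i = \sum_(q < m) gap W i q * w 0 q.
Proof.
move=> w_strat; apply: eq_bigr => q _; have /andP[wq_ge0 _] := w_strat q.
rewrite mulrBl mxE eqxx; congr (_ - _).
rewrite (big_morph (fun x => x * w 0 q) (id1 := 0) (op1 := Num.max)).
- by apply: eq_bigr => j /negPf ne_ji; rewrite mxE ne_ji.
- by move=> x y; rewrite maxr_pMl.
- by rewrite mul0r.
Qed.

(** Necessity uses the deviation that alters one weight only; sufficiency sums
    the inequalities over all tasks. *)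
Lemma nashP W : is_profile W ->
  is_nash f W <-> forall i q, optimal_weight (gap W i q) (W i q).
Proof.
move=> W_profile.
have utilityE i : utility f W i = \sum_(q < m) gap W i q * W i q.
  rewrite -{1}(deviate_row W i) utility_deviate //.
  by apply: eq_bigr => q _; rewrite mxE.
split=> [nash i q t t01 | opt i w w_strat]; last first.
  by rewrite utility_deviate // utilityE; apply: ler_sum => q _; apply: opt.
pose w : 'rV[R]_m := \row_p (if p == q then t else W i p).
have w_strat : is_strategy w.
  by move=> p; rewrite mxE; case: eqP => // _; have := W_profile i p; rewrite mxE.
have := nash i w w_strat.
rewrite utility_deviate // utilityE (bigD1 q) //= [leRHS](bigD1 q) //=.
rewrite mxE eqxx.
under eq_bigr => p /negPf ne_pq do rewrite mxE ne_pq.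
by rewrite lerD2r.
Qed.

Lemma dominatingP i q :
  reflect (dominating f i q) [forall j, f j q <= f i q].
Proof. exact: forallP. Qed.

Lemma not_dominating_lt i j q :
  dominating f i q -> ~ dominating f j q -> f j q < f i q.
Proof.
move=> dom_i ndom_j; rewrite ltNge; apply/negP=> le_ij.
by apply: ndom_j => k; apply: le_trans (dom_i k) le_ij.
Qed.

Hypothesis f_ge0 : forall i q, 0 <= f i q.

(** An agent that fails to dominate both shows that there are agents to
    maximise over and, by [0 <= f], separates the maximum from 0. *)
Lemma exists_dominating_gt0 q :
  ~ (forall i, dominating f i q) -> exists i, dominating f i q /\ 0 < f i q.
Proof.
move=> not_all.
have /existsP[k /dominatingP ndom_k] :
    [exists k, ~~ [forall j, f j q <= f k q]].
  rewrite -negb_forall; apply/negP=> /forallP all_dom.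
  by apply: not_all => i; apply/dominatingP.
case: (arg_maxP (fun i => f i q) (isT : predT k)) => i _ max_i.
have dom_i : dominating f i q by move=> j; apply: max_i.
by exists i; split=> //;
  apply: le_lt_trans (f_ge0 k q) (not_dominating_lt dom_i ndom_k).
Qed.

Lemma gap_le W i j q : j != i -> W j q = 1 -> gap W i q <= f i q - f j q.
Proof.
move=> ne_ji Wj1; rewrite lerD2l lerN2.
by have := @le_bigmax_cond _ _ _ 0 j (fun k => k != i)
  (fun k => f k q * W k q) ne_ji; rewrite Wj1 mulr1.
Qed.

Lemma gap_lt0 W i j q : dominating f i q -> W i q = 1 ->
  ~ dominating f j q -> gap W j q < 0.
Proof.
move=> dom_i Wi1 ndom_j.
have ne_ij : i != j by apply/eqP=> eq_ij; apply: ndom_j; rewrite -eq_ij.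
apply: le_lt_trans (gap_le ne_ij Wi1) _.
by rewrite subr_lt0 not_dominating_lt.
Qed.

Section Profile.

Variable W : 'M[R]_(n, m).
Hypothesis W_profile : is_profile W.

Lemma profile01 i q : 0 <= W i q <= 1.
Proof. by have := W_profile i q; rewrite mxE. Qed.

Lemma gap_ge0 i q : dominating f i q -> 0 <= gap W i q.
Proof.
move=> dom_i; rewrite subr_ge0; apply: bigmax_le => // j _.
have /andP[_ Wj_le1] := profile01 j q.
by apply: le_trans (dom_i j); rewrite ler_piMr.
Qed.

(** A discounted value stays below the maximal value for one of two reasons:
    the weight is below 1 if the agent is dominating, the value is below the
    maximal one if it is not. The maximum in the slope starts
    at 0, whence the hypothesis [0 < f i q]. *)
Lemma gap_gt0 i q : dominating f i q -> 0 < f i q ->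
  (forall j, dominating f j q -> W j q != 1) -> 0 < gap W i q.
Proof.
move=> dom_i fi_gt0 no_full; rewrite subr_gt0; apply: bigmax_lt => // j _.
have /andP[_ Wj_le1] := profile01 j q.
case: (dominatingP j q) => [dom_j | ndom_j]; last first.
  by apply: le_lt_trans (not_dominating_lt dom_i ndom_j); rewrite ler_piMr.
have fj_gt0 : 0 < f j q by apply: lt_le_trans fi_gt0 (dom_j i).
by apply: lt_le_trans (dom_i j); rewrite gtr_pMr // lt_neqAle no_full.
Qed.

End Profile.

End WeightGame.

Theorem mainTheorem2 (R : realType) (n m : nat) (f : 'I_n -> 'I_m -> R)
    (f_ge0 : forall (i : 'I_n) (q : 'I_m), 0 <= f i q)
    (not_all_dominating :
       forall q : 'I_m, ~ (forall i : 'I_n, dominating f i q))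
    (W : 'M[R]_(n, m)) (W_profile : is_profile W) :
  is_nash f W <->
    (forall q : 'I_m, exists i : 'I_n, dominating f i q /\ W i q = 1) /\
    (forall (j : 'I_n) (q : 'I_m), ~ dominating f j q -> W j q = 0).
Proof.
apply: iff_trans (nashP f W_profile) _; have W01 := profile01 W_profile.
split=> [opt | [full zero] i q].
  have full q : exists i, dominating f i q /\ W i q = 1.
    have [i [dom_i fi_gt0]] := exists_dominating_gt0 f_ge0 (@not_all_dominating q).
    case: (boolP [exists j, [forall k, f k q <= f j q] && (W j q == 1)]).
      by case/existsP=> j /andP[/dominatingP dom_j /eqP Wj1]; exists j.
    move=> /existsPn no_full; exists i; split=> //.
    have [pos _] := (optimal_weightP _ (W01 i q)).1 (opt i q).
    apply/pos/(gap_gt0 f_ge0) => // j /dominatingP dom_j.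
    by have := no_full j; rewrite dom_j.
  split=> // j q ndom_j; have [i [dom_i Wi1]] := full q.
  have [_ neg] := (optimal_weightP _ (W01 j q)).1 (opt j q).
  exact/neg/(gap_lt0 dom_i Wi1 ndom_j).
apply/(optimal_weightP _ (W01 i q)); split=> [gap_pos | gap_neg].
  have [j [dom_j Wj1]] := full q.
  case: (eqVneq j i) => [<- // | ne_ji].
  (* [i] faces full weight on a maximal value, so its slope is not positive. *)
  have := lt_le_trans gap_pos (gap_le f ne_ji Wj1).
  by rewrite subr_gt0 ltNge dom_j.
apply: zero => dom_i.
by have := gap_ge0 f_ge0 W_profile dom_i; rewrite leNgt gap_neg.
Qed.
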